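(* Let $k\ge 1$. Every $(k+1)$-ary propositional exclusion atom is equivalent to some formula $\phi\in\mathcal{QPL}(\mid_k)_4$, that is, to a formula of quantified propositional logic extended with exclusion atoms, containing at most $4$ occurrences of exclusion atoms, each of arity at most $k$.
   Context: Let $\mathrm{Prop}$ be a countably infinite set of propositional symbols. Formulas of quantified propositional logic $\mathcal{QPL}$: $\phi::=p\mid\neg p\mid(\phi\wedge\phi)\mid(\phi\vee\phi)\mid\exists p\,\phi\mid\forall p\,\phi$ with $p\in\mathrm{Prop}$. $\mathrm{FV}(\phi)$ is the set of free propositional symbols. A team $T$ over a finite set of symbols $V=\mathrm{Var}(T)$ is a set of evaluations $s:V\to\{0,1\}$. For $\bar p=p_1\dots p_k$, $s(\bar p)=s(p_1)\dots s(p_k)$. $s(a/p)$ maps $p$ to $a$ and agrees with $s$ elsewhere. Semantics: $T\models p$ iff $s(p)=1$ for all $s\in T$; $T\models\neg p$ iff $s(p)=0$ for all $s\in T$; $T\models\phi\wedge\psi$ iff $T\models\phi$ and $T\models\psi$; $T\models\phi\vee\psi$ iff there are $S,S'\subseteq T$ with $S\cup S'=T$, $S\models\phi$, $S'\models\psi$; $T\models\exists p\,\phi$ iff there is $F:T\to\{\{0\},\{1\},\{0,1\}\}$ with $\{s(a/p)\mid s\in T,a\in F(s)\}\models\phi$; $T\models\forall p\,\phi$ iff $\{s(a/p)\mid s\in T,a\in\{0,1\}\}\models\phi$. Exclusion atom of arity $|\bar p|=|\bar q|$ (sequences of propositional symbols): $T\models\bar p\mid\bar q$ iff $s(\bar p)\ne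 s'(\bar q)$ for all $s,s'\in T$. $\mathcal{QPL}(\mid_k)_n$ is the set of formulas of the extension of $\mathcal{QPL}$ by (unnegated) exclusion atoms with at most $n$ occurrences of exclusion atoms, each of arity at most $k$. Equivalence $\phi\equiv\psi$ means $\mathrm{FV}(\phi)=\mathrm{FV}(\psi)$ and $T\models\phi\iff T\models\psi$ for every team $T$ with $\mathrm{FV}(\phi)\subseteq\mathrm{Var}(T)$. *)

(* Defs.v *)
From mathcomp Require Import all_boot finmap.

Set Implicit Arguments.
Unset Strict Implicit.
Unset Printing Implicit Defensive.

Local Open Scope fset_scope.
Local Open Scope fmap_scope.

(* The natural numbers serve as the countably infinite set Prop. *)
Notation symbol := nat (only parsing).

Inductive formula : Type :=
  | Pos of symbol
  | Neg of symbol
  | And of formula & formula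
  | Or of formula & formula
  | Exists of symbol & formula
  | Forall of symbol & formula
  | Excl (m : nat) (ps qs : m.-tuple symbol).

Fixpoint FV (phi : formula) : {fset symbol} :=
  match phi with
  | Pos p | Neg p => [fset p]
  | And phi1 phi2 | Or phi1 phi2 => FV phi1 `|` FV phi2
  | Exists p phi1 | Forall p phi1 => FV phi1 `\ p
  | Excl m ps qs => [fset x in (ps : seq symbol)] `|` [fset x in (qs : seq symbol)]
  end.

Fixpoint num_excl (phi : formula) : nat :=
  match phi with
  | Pos _ | Neg _ => 0
  | And phi1 phi2 | Or phi1 phi2 => num_excl phi1 + num_excl phi2
  | Exists _ phi1 | Forall _ phi1 => num_excl phi1
  | Excl _ _ _ => 1
  end.

Fixpoint excl_arity_le (k : nat) (phi : formula) : bool :=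
  match phi with
  | Pos _ | Neg _ => true
  | And phi1 phi2 | Or phi1 phi2 => excl_arity_le k phi1 && excl_arity_le k phi2
  | Exists _ phi1 | Forall _ phi1 => excl_arity_le k phi1
  | Excl m _ _ => m <= k
  end.

(* The class QPL(|_k)_n *)
Definition QPL_excl (k n : nat) (phi : formula) : Prop :=
  (num_excl phi <= n)%N /\ excl_arity_le k phi.

(* An evaluation is a finite map carrying its own domain, so that updating
   with [s.[p <- a]] adds p to the domain when it is not already there. *)
Definition evaluation := {fmap symbol -> bool}.

(* A team over V is a finite set of evaluations satisfying [team_over V]; the
   empty team is a team over every V. *)
Definition team := {fset evaluation}.

Definition team_over (V : {fset symbol}) (T : team) : Prop :=
  forall s : evaluation, s \in T -> domf s = V.

(* s(ps) = s(p_1)...s(p_m); all entries are of the form [Some _] when the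
   symbols lie in the domain of s. *)
Definition eval_seq (s : evaluation) (ps : seq symbol) : seq (option bool) :=
  [seq s.[? p] | p <- ps].

(* Only meaningful when every evaluation in T is defined on FV phi. *)
Fixpoint sat (T : team) (phi : formula) : Prop :=
  match phi with
  | Pos p => forall s : evaluation, s \in T -> s.[? p] = Some true
  | Neg p => forall s : evaluation, s \in T -> s.[? p] = Some false
  | And phi1 phi2 => sat T phi1 /\ sat T phi2
  | Or phi1 phi2 =>
      exists S S' : team,
        [/\ S `<=` T, S' `<=` T, S `|` S' = T, sat S phi1 & sat S' phi2]
  | Exists p phi1 =>
      exists F : evaluation -> {set bool},
        (forall s : evaluation, s \in T ->
           F s \in [:: [set false]; [set true]; [set false; true]]) /\
        sat [fset s.[p <- a] | s in T, a in F s] phi1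
  | Forall p phi1 =>
      sat [fset s.[p <- a] | s in T, a in [set: bool]] phi1
  | Excl m ps qs =>
      forall s s' : evaluation, s \in T -> s' \in T -> eval_seq s ps <> eval_seq s' qs
  end.

Definition equivalent (phi psi : formula) : Prop :=
  FV phi = FV psi /\
  forall (V : {fset symbol}) (T : team),
    team_over V T -> FV phi `<=` V -> (sat T phi <-> sat T psi).

(* Main.v *)
Require Import Defs.
From mathcomp Require Import all_boot finmap.

(** The disjointness of the values of [p :: ps] and [q :: qs] is checked
separately for each value [a] of the first symbol: the values of [ps] under
[p = a] must avoid those of [qs] under [q = a].  One copies [ps] into a fresh
tuple [rs] when [p = a], copies [qs] into a fresh [rs'] when [q = a], and
requires [rs | rs'].  Elsewhere [rs] repeats a value taken by [ps] under
[p = a], and similarly [rs'].  This is impossible when [p = a] or [q = a] never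
occurs, but then there is nothing to check; this case is selected by a bit [d],
by copying [ps /\ d] and [qs /\ d] instead.  The bit has to be the same in the
whole team, which is expressed by [c | d] together with [c <> d].  Each of the
two values of [a] thus uses two exclusion atoms. *)

Set Implicit Arguments.
Unset Strict Implicit.
Unset Printing Implicit Defensive.

Local Open Scope fset_scope.
Local Open Scope fmap_scope.

(** * Flat formulas: team truth is pointwise truth *)

Fixpoint flat (phi : formula) : bool :=
  match phi with
  | Pos _ | Neg _ => true
  | And phi1 phi2 | Or phi1 phi2 => flat phi1 && flat phi2
  | Exists _ _ | Forall _ _ | Excl _ _ _ => false
  end.

(** The value [false] on quantifiers and atoms is only a default outside the flat fragment. *)
Fixpoint holds (s : evaluation) (phi : formula) : bool :=
  match phi with
  | Pos p => s.[? p] == Some true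
  | Neg p => s.[? p] == Some false
  | And phi1 phi2 => holds s phi1 && holds s phi2
  | Or phi1 phi2 => holds s phi1 || holds s phi2
  | Exists _ _ | Forall _ _ | Excl _ _ _ => false
  end.

(** Only disjunction needs an argument: the team splits into the evaluations satisfying each
    disjunct. *)
Lemma sat_flat (phi : formula) (T : team) :
  flat phi -> sat T phi <-> {in T, forall s, holds s phi}.
Proof.
elim: phi T => //=.
- by move=> p T _; split=> H s sT; apply/eqP; apply: H.
- by move=> p T _; split=> H s sT; apply/eqP; apply: H.
- move=> f IHf g IHg T /andP[/IHf {}IHf /IHg {}IHg]; split.
    by move=> [/IHf Hf /IHg Hg] s sT; rewrite Hf // Hg.
  by move=> H; split; [apply/IHf|apply/IHg] => s /H /andP[].
- move=> f IHf g IHg T /andP[/IHf {}IHf /IHg {}IHg]; split.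
    move=> [S [S' [_ _ <- /IHf Hf /IHg Hg]]] s.
    by rewrite inE => /orP[/Hf->|/Hg->]; rewrite ?orbT.
  move=> H; exists [fset s in T | holds s f], [fset s in T | holds s g]; split.
  + by apply/fsubsetP=> s; rewrite !inE => /andP[].
  + by apply/fsubsetP=> s; rewrite !inE => /andP[].
  + apply/fsetP=> s; rewrite !inE -andb_orr.
    by case sT: (s \in T); rewrite //= H.
  + by apply/IHf=> s; rewrite !inE => /andP[].
  + by apply/IHg=> s; rewrite !inE => /andP[].
Qed.

(** * Blocks of existential quantifiers *)

Definition exs (xs : seq nat) (phi : formula) : formula := foldr Exists phi xs.

Lemma FV_exs (xs : seq nat) (phi : formula) (y : nat) :
  (y \in FV (exs xs phi)) = (y \notin xs) && (y \in FV phi).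
Proof. by elim: xs => //= x xs IH; rewrite !inE IH negb_or andbA. Qed.

Lemma num_excl_exs (xs : seq nat) (phi : formula) :
  num_excl (exs xs phi) = num_excl phi.
Proof. by elim: xs. Qed.

Lemma excl_arity_le_exs (k : nat) (xs : seq nat) (phi : formula) :
  excl_arity_le k (exs xs phi) = excl_arity_le k phi.
Proof. by elim: xs. Qed.

(** Reassignment of [xs] turning [s] into [t]; boolean, so that it can define the choice sets of
    [Exists]. *)
Fixpoint variant (xs : seq nat) (s t : evaluation) : bool :=
  if xs is x :: xs' then variant xs' s.[x <- true] t || variant xs' s.[x <- false] t
  else s == t.

Lemma variantP (x : nat) (xs : seq nat) (s t : evaluation) :
  reflect (exists a, variant xs s.[x <- a] t) (variant (x :: xs) s t).
Proof.
apply: (iffP orP) => [[H|H]|[[] H]]; by [exists true|exists false|left|right].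
Qed.

Lemma variant_out (xs : seq nat) (s t : evaluation) (y : nat) :
  variant xs s t -> y \notin xs -> t.[? y] = s.[? y].
Proof.
elim: xs s => [|x xs IH] s; first by move=> /eqP->.
case/variantP=> a /IH H; rewrite inE negb_or => /andP[yx /H->].
by rewrite fnd_set (negbTE yx).
Qed.

(** The three admissible choice sets are exactly the nonempty sets of booleans. *)
Lemma choice_setP (A : {set bool}) :
  (A \in [:: [set false]; [set true]; [set false; true]]) <-> exists a, a \in A.
Proof.
split.
  rewrite !inE => /or3P[] /eqP->; [exists false|exists true|exists true];
  by rewrite !inE.
move=> [a aA]; rewrite !inE.
have E (B : {set bool}) : (A == B) = ((true \in A) == (true \in B)) && ((false \in A) == (false \in B)).
  apply/eqP/andP=> [->//|[/eqP E1 /eqP E2]].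
  by apply/setP=> -[].
by rewrite !E !inE /=; case: a aA => ->; case: (_ \in A).
Qed.

(* The lax semantics of [Exists] is what allows an arbitrary team of variants. *)
Lemma sat_exs (xs : seq nat) (phi : formula) (T : team) :
  sat T (exs xs phi) <->
  exists T' : team,
    [/\ sat T' phi,
        {in T, forall s, exists2 t, t \in T' & variant xs s t}
      & {in T', forall t, exists2 s, s \in T & variant xs s t}].
Proof.
elim: xs T => [|x xs IH] T.
  split=> [H|[T' [H H1 H2]]].
    by exists T; split=> // s sT; exists s => //=.
  suff -> : T = T' by [].
  apply/fsetP=> s; apply/idP/idP.
    by case/H1=> t tT' /eqP->.
  by case/H2=> t tT' /eqP<-.
split.
  move=> [F [HF /IH[T' [H H1 H2]]]]; exists T'; split=> //.
    move=> s sT; have /choice_setP[a aF] := HF s sT.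
    have /H1[t tT' v] : s.[x <- a] \in [fset s.[x <- a] | s in T, a in F s].
      by apply/imfset2P; exists s => //; exists a.
    by exists t => //; apply/variantP; exists a.
  move=> t /H2[_ /imfset2P[s /= sT [a _ ->]] v].
  by exists s => //; apply/variantP; exists a.
move=> [T' [H H1 H2]].
(* Keep every value from which [T'] is still reachable; there is one because [s] has a variant in
   [T']. *)
exists (fun s => [set a | has (variant xs s.[x <- a]) T']); split.
  move=> s /H1[t tT' /variantP[a v]]; apply/choice_setP.
  by exists a; rewrite inE; apply/hasP; exists t.
apply/IH; exists T'; split=> //.
  by move=> _ /imfset2P[s /= sT [a aF ->]]; move: aF; rewrite inE => /hasP.
move=> t tT'; have [s sT /variantP[a v]] := H2 t tT'.
exists s.[x <- a] => //; apply/imfset2P; exists s => //; exists a => //.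
by rewrite inE; apply/hasP; exists t.
Qed.

(** * Prescribing and reading values of symbols *)

Definition update (xs : seq nat) (f : nat -> bool) (s : evaluation) : evaluation :=
  foldl (fun s x => s.[x <- f x]) s xs.

Lemma variant_update (xs : seq nat) (f : nat -> bool) (s : evaluation) :
  variant xs s (update xs f s).
Proof.
by elim: xs s => //= x xs IH s; apply/(variantP x); exists (f x).
Qed.

Lemma update_in (xs : seq nat) (f : nat -> bool) (s : evaluation) (y : nat) :
  y \in xs -> (update xs f s).[? y] = Some (f y).
Proof.
(* A later occurrence of [y] writes the same value [f y], so repetitions do no harm. *)
elim: xs s => //= x xs IH s; case yxs: (y \in xs); first by rewrite IH.
rewrite inE yxs orbF => /eqP<-.
by rewrite (variant_out (variant_update _ _ _)) ?yxs // fnd_set eqxx.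
Qed.

(** The symbol [n + l] receives entry [l] of [vs], so a block of consecutive symbols reads a slice
    of [vs]. *)
Lemma eval_update_iota (n m i j : nat) (vs : seq bool) (s : evaluation) :
  (n <= i)%N -> (i + j <= n + m)%N -> (i - n + j <= size vs)%N ->
  eval_seq (update (iota n m) (fun y => nth false vs (y - n)) s) (iota i j) =
  [seq Some b | b <- take j (drop (i - n) vs)].
Proof.
move=> ni ijm ijs; have szt : size (take j (drop (i - n) vs)) = j.
  by rewrite size_takel // size_drop leq_subRL ?(leq_trans _ ijs) ?leq_addr.
apply: (@eq_from_nth _ None); first by rewrite !size_map size_iota szt.
rewrite size_map size_iota => l lj.
rewrite (nth_map 0) ?size_iota // nth_iota // (nth_map false) ?szt //.
rewrite nth_take // nth_drop addnBAC // update_in //.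
rewrite mem_iota (leq_trans ni) ?leq_addr //=.
by apply: leq_trans ijm; rewrite ltn_add2l.
Qed.

Lemma eval_seq_variant (xs ys : seq nat) (s t : evaluation) :
  variant xs s t -> {in ys, forall y, y \notin xs} -> eval_seq t ys = eval_seq s ys.
Proof. by move=> v Hys; apply/eq_in_map=> y /Hys /(variant_out v). Qed.

(** An undefined symbol is read as [false]. *)
Definition val1 (s : evaluation) (x : nat) : bool := s.[? x] == Some true.

Lemma val1K (s : evaluation) (x : nat) : x \in domf s -> s.[? x] = Some (val1 s x).
Proof. by move=> xs; rewrite /val1 in_fnd //; case: (s.[_]). Qed.

Lemma eval_seq_val1 (s : evaluation) (xs : seq nat) :
  {subset xs <= domf s} -> eval_seq s xs = [seq Some b | b <- map (val1 s) xs].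
Proof. by move=> H; rewrite -map_comp; apply/eq_in_map=> x /H /val1K. Qed.

(** * Formulas that force conditional copies *)

Definition lit (a : bool) (p : nat) : formula := if a then Pos p else Neg p.

Lemma holds_lit (s : evaluation) (a : bool) (p : nat) :
  holds s (lit a p) = (s.[? p] == Some a).
Proof. by case: a. Qed.

Definition neq_form (c d : nat) : formula :=
  Or (And (Pos c) (Neg d)) (And (Neg c) (Pos d)).

(** The equivalence of [r] with the conjunction of [p] and [d], in negation normal form. *)
Definition and_form (d r p : nat) : formula :=
  Or (And (Pos r) (And (Pos p) (Pos d))) (And (Neg r) (Or (Neg p) (Neg d))).

Lemma and_form_val (s : evaluation) (d r p : nat) :
  holds s (and_form d r p) -> s.[? r] = Some (val1 s p && val1 s d).
Proof.
rewrite /= /val1.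
by case/orP=> /andP[/eqP->] => [/andP[/eqP-> /eqP->]|/orP[]/eqP->]; rewrite ?andbF.
Qed.

Lemma holds_and_form (s : evaluation) (d r p : nat) :
  d \in domf s -> p \in domf s ->
  s.[? r] = Some (val1 s p && val1 s d) -> holds s (and_form d r p).
Proof.
move=> /val1K Ed /val1K Ep Er; rewrite /= Er Ed Ep.
by case: (val1 s d); case: (val1 s p).
Qed.

(** The negated literal encodes an implication: where [p] is not [a], the symbols [rs] are
    unconstrained. *)
Definition copy_form (a : bool) (p d : nat) (rs ps : seq nat) : seq formula :=
  [seq Or (lit (~~ a) p) (and_form d x.1 x.2) | x <- zip rs ps].

Lemma copy_form_val (s : evaluation) (a : bool) (p d : nat) (rs ps : seq nat) :
  size rs = size ps -> s.[? p] = Some a -> all (holds s) (copy_form a p d rs ps) ->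
  eval_seq s rs = [seq Some (val1 s x && val1 s d) | x <- ps].
Proof.
move=> + sp; elim: rs ps => [|r rs IH] [|x ps] //= [szE].
rewrite holds_lit sp.
have -> : (Some a == Some (~~ a)) = false by case: (a).
by case/andP=> /and_form_val-> /(IH _ szE)->.
Qed.

Lemma holds_copy_form (s : evaluation) (a : bool) (p d : nat) (rs ps : seq nat) :
  d \in domf s -> p \in domf s -> {subset ps <= domf s} -> size rs = size ps ->
  (s.[? p] = Some a -> eval_seq s rs = [seq Some (val1 s x && val1 s d) | x <- ps]) ->
  all (holds s) (copy_form a p d rs ps).
Proof.
move=> ds /[dup] pd /val1K Ep; elim: rs ps => [|r rs IH] [|x ps] //= Hps [szE] H.
have [xs Hps'] : x \in domf s /\ {subset ps <= domf s}.
  by split=> [|y yps]; apply: Hps; rewrite inE ?eqxx ?yps ?orbT.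
apply/andP; split; last by apply: IH => // /H[].
rewrite holds_lit Ep (inj_eq Some_inj); case: (altP eqP) => //= nE.
have /H[/(holds_and_form ds xs)] : s.[? p] = Some a; last by [].
by rewrite Ep; move: nE; case: (val1 s p); case: (a).
Qed.

Lemma flat_copy_form (a : bool) (p d : nat) (rs ps : seq nat) :
  all flat (copy_form a p d rs ps).
Proof. by rewrite all_map; apply/allP=> x _ /=; case: a. Qed.

(** [p] and [d] occur only inside the conjuncts, hence the condition that [ps] be nonempty. *)
Lemma FV_copy_form (a : bool) (p d : nat) (rs ps : seq nat) (y : nat) :
  size rs = size ps ->
  has (fun f => y \in FV f) (copy_form a p d rs ps) =
  [|| (ps != [::]) && ((y == p) || (y == d)), y \in rs | y \in ps].
Proof.
have FVl b z : FV (lit b z) = [fset z] by case: b.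
elim: rs ps => [|r rs IH] [|x ps] //= [szE].
rewrite IH // FVl !inE.
by case: (y == p); case: (y == d); case: (y == r); case: (y == x) => //=;
  case: (y \in rs); case: (y \in ps); rewrite ?andbF ?orbT.
Qed.

(** The last conjunct [f] replaces a truth constant, which the syntax does not have. *)
Definition conj_form (fs : seq formula) (f : formula) : formula := foldr And f fs.

Lemma holds_conj (s : evaluation) (fs : seq formula) (f : formula) :
  holds s (conj_form fs f) = all (holds s) fs && holds s f.
Proof. by elim: fs => //= g fs ->; rewrite andbA. Qed.

Lemma flat_conj (fs : seq formula) (f : formula) :
  flat (conj_form fs f) = all flat fs && flat f.
Proof. by elim: fs => //= g fs ->; rewrite andbA. Qed.

Lemma FV_conj (fs : seq formula) (f : formula) (y : nat) :
  (y \in FV (conj_form fs f)) = has (fun g => y \in FV g) fs || (y \in FV f).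
Proof. by elim: fs => //= g fs IH; rewrite inE IH orbA. Qed.

Lemma flat_num_excl (f : formula) : flat f -> num_excl f = 0.
Proof. by elim: f => //= f IHf g IHg /andP[/IHf-> /IHg->]. Qed.

Lemma flat_excl_arity_le (k : nat) (f : formula) : flat f -> excl_arity_le k f.
Proof. by elim: f => //= f IHf g IHg /andP[/IHf-> /IHg->]. Qed.

(** * The formula for one value [a] of the first symbols *)

Definition branch_matrix (a : bool) (k n p q : nat) (ps qs : seq nat) : formula :=
  conj_form (copy_form a p n.+1 (iota n.+2 k) ps ++
             copy_form a q n.+1 (iota (n.+2 + k) k) qs)
            (neq_form n n.+1).

(* The bits [c] and [d] are [n] and [n.+1]; the two copies come next. *)
Definition branch (a : bool) (k n p q : nat) (ps qs : seq nat) : formula :=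
  exs (iota n (k + k).+2)
    (And (And (Excl [tuple n] [tuple n.+1])
              (Excl (iota_tuple k n.+2) (iota_tuple k (n.+2 + k))))
         (branch_matrix a k n p q ps qs)).

Lemma flat_branch_matrix (a : bool) (k n p q : nat) (ps qs : seq nat) :
  flat (branch_matrix a k n p q ps qs).
Proof. by rewrite flat_conj all_cat !flat_copy_form. Qed.

Lemma num_excl_branch (a : bool) (k n p q : nat) (ps qs : seq nat) :
  num_excl (branch a k n p q ps qs) = 2.
Proof.
by rewrite num_excl_exs /= flat_num_excl ?flat_branch_matrix.
Qed.

Lemma excl_arity_le_branch (a : bool) (k n p q : nat) (ps qs : seq nat) :
  0 < k -> excl_arity_le k (branch a k n p q ps qs).
Proof.
move=> k0; rewrite excl_arity_le_exs /= k0 leqnn /=.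
exact/flat_excl_arity_le/flat_branch_matrix.
Qed.

Lemma FV_Excl (m : nat) (ps qs : m.-tuple nat) (y : nat) :
  (y \in FV (Excl ps qs)) = (y \in (ps : seq nat)) || (y \in (qs : seq nat)).
Proof. by rewrite in_fsetU !in_fset. Qed.

(** * Free symbols and correctness of a branch *)

Section Branch.

Variables (a : bool) (k n p q : nat) (ps qs : seq nat).
Hypotheses (k_gt0 : 0 < k) (szps : size ps = k) (szqs : size qs = k).
Hypothesis fresh : {in (p :: ps) ++ (q :: qs), forall y, y < n}.

Let xs := iota n (k + k).+2.

Let fresh_xs y : y \in (p :: ps) ++ (q :: qs) -> y \notin xs.
Proof. by move=> /fresh yn; rewrite mem_iota negb_and -ltnNge yn. Qed.

Lemma FV_branch (y : nat) :
  (y \in FV (branch a k n p q ps qs)) = (y \in (p :: ps) ++ (q :: qs)).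
Proof.
(* Positivity of [k] ensures that [p] and [q] really occur in the copying formulas. *)
have psN : ps != [::] by rewrite -size_eq0 szps -lt0n.
have qsN : qs != [::] by rewrite -size_eq0 szqs -lt0n.
have FV_And f g : (y \in FV (And f g)) = (y \in FV f) || (y \in FV g).
  exact: in_fsetU.
rewrite FV_exs !FV_And !FV_Excl FV_conj has_cat !FV_copy_form ?size_iota //.
rewrite psN qsN; apply/andP/idP; last first.
  move=> H; split; first exact: fresh_xs.
  by move: H; rewrite mem_cat !(inE, mem_cat) => /orP[/orP[]->|/orP[]->]; rewrite ?orbT.
have xsE : iota n (k + k).+2 = [:: n, n.+1 & iota n.+2 k ++ iota (n.+2 + k) k].
  by rewrite /= iotaD.
rewrite xsE !inE !mem_cat !inE !negb_or.
move=> [/and4P[/negbTE-> /negbTE-> /negbTE-> /negbTE->]].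
by case: (y == p); case: (y == q); case: (y \in ps); case: (y \in qs).
Qed.

Variable T : team.
Hypothesis Tdom : {in T, forall s : evaluation, {subset (p :: ps) ++ (q :: qs) <= domf s}}.

(** Variants [t] and [t'] share the bit [d], so equal values of [ps] and [qs] would yield equal
    copies, against the [k]-ary atom. *)
Lemma branch_sound (s s' : evaluation) :
  sat T (branch a k n p q ps qs) -> s \in T -> s' \in T ->
  s.[? p] = Some a -> s'.[? q] = Some a -> eval_seq s ps <> eval_seq s' qs.
Proof.
move=> /sat_exs[T' [[[Hc Hr] /(sat_flat _ (flat_branch_matrix _ _ _ _ _ _ _)) H] H1 _]].
move=> /H1[t tT' vt] /H1[t' t'T' vt'] sp sq Epq.
have {}sp : t.[? p] = Some a.
  by rewrite (variant_out vt) // fresh_xs ?mem_head.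
have {}sq : t'.[? q] = Some a.
  by rewrite (variant_out vt') // fresh_xs // mem_cat mem_head orbT.
have {}Epq : eval_seq t ps = eval_seq t' qs.
  rewrite (eval_seq_variant vt) ?(eval_seq_variant vt') // => y yin;
  by apply: fresh_xs; rewrite mem_cat !inE yin ?orbT.
(* As [c] is the complement of [d] in each evaluation, [c] in [t] avoiding [d] in [t'] makes the two
   bits [d] equal. *)
have Ed : val1 t n.+1 = val1 t' n.+1.
  have neqP u : u \in T' -> u.[? n] = Some (~~ val1 u n.+1) /\
                            u.[? n.+1] = Some (val1 u n.+1).
    move=> /H; rewrite holds_conj => /andP[_].
    by rewrite /= /val1 => /orP[] /andP[/eqP-> /eqP->].
  have [cE dE] := neqP _ tT'; have [cE' dE'] := neqP _ t'T'.
  have := Hc _ _ tT' t'T'; have := Hc _ _ t'T' tT'.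
  by rewrite /eval_seq /= cE cE' dE dE'; case: (val1 t _); case: (val1 t' _).
apply: (Hr _ _ tT' t'T').
have := H _ tT'; rewrite holds_conj all_cat => /andP[/andP[Hps _] _].
have := H _ t'T'; rewrite holds_conj all_cat => /andP[/andP[_ Hqs] _].
rewrite /= (copy_form_val _ sp Hps) ?(copy_form_val _ sq Hqs) ?size_iota //.
have mapE u zs : [seq Some (val1 u x && val1 u n.+1) | x <- zs] =
                 [seq Some ((o == Some true) && val1 u n.+1) | o <- eval_seq u zs].
  by rewrite -map_comp.
by rewrite !mapE Epq Ed.
Qed.

(* When [A] does not occur, [R] and [R'] may be chosen constant and distinct. *)
Lemma copy_values (A B : evaluation -> bool) :
  {in T &, forall s s', A s -> B s' -> map (val1 s) ps <> map (val1 s') qs} ->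
  exists (d : bool) (R R' : evaluation -> seq bool),
    [/\ forall s, size (R s) = k, forall s, size (R' s) = k,
        {in T, forall s, A s -> R s = [seq val1 s x && d | x <- ps]},
        {in T, forall s, B s -> R' s = [seq val1 s x && d | x <- qs]} &
        {in T &, forall s s', R s <> R' s'}].
Proof.
move=> AB.
have zeros s zs : size zs = k -> nseq k false = [seq val1 s x && false | x <- zs].
  by move=> <-; elim: zs => //= x zs ->; rewrite andbF.
have nseq_neq b : nseq k b <> nseq k (~~ b).
  by case: (k) k_gt0 => // ? _ []; case: b.
have [/hasP[u uT uA]|nA] := boolP (has A T); last first.
  (* With [d] false the copy of [qs] must be all zeros wherever [B] holds, so [R] is taken all
     ones. *)
  exists false, (fun=> nseq k true), (fun=> nseq k false).
  split=> [s|s|s sT sA|s _ _|_ _ _ _].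
  - exact: size_nseq.
  - exact: size_nseq.
  - by move/hasPn/(_ s sT): nA; rewrite sA.
  - exact: zeros.
  - exact: (nseq_neq true).
have [/hasP[v vT vB]|nB] := boolP (has B T); last first.
  exists false, (fun=> nseq k false), (fun=> nseq k true).
  split=> [s|s|s _ _|s sT sB|_ _ _ _].
  - exact: size_nseq.
  - exact: size_nseq.
  - exact: zeros.
  - by move/hasPn/(_ s sT): nB; rewrite sB.
  - exact: (nseq_neq false).
(* Outside [A] the values of [u] are borrowed, outside [B] those of [v]; every comparison is then
   between an evaluation in [A] and one in [B]. *)
exists true, (fun s => map (val1 (if A s then s else u)) ps),
  (fun s => map (val1 (if B s then s else v)) qs).
split=> [s|s|s _ ->|s _ ->|s s' sT s'T]; rewrite ?size_map //.
- by apply/eq_map=> x; rewrite andbT.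
- by apply/eq_map=> x; rewrite andbT.
- by apply: AB; case: ifP.
Qed.

(** One variant [up s] per evaluation suffices: it stores the values supplied by [copy_values] in
    the fresh symbols. *)
Lemma branch_complete :
  {in T &, forall s s' : evaluation, s.[? p] = Some a -> s'.[? q] = Some a ->
     eval_seq s ps <> eval_seq s' qs} ->
  sat T (branch a k n p q ps qs).
Proof.
move=> Hex.
have Tps s : s \in T -> {subset ps <= domf s}.
  by move=> sT y yps; apply: (Tdom sT); rewrite mem_cat inE yps orbT.
have Tqs s : s \in T -> {subset qs <= domf s}.
  by move=> sT y yqs; apply: (Tdom sT); rewrite mem_cat !inE yqs !orbT.
have [|d [R [R' [szR szR' RA RB RR']]]] :=
  @copy_values (fun s => s.[? p] == Some a) (fun s => s.[? q] == Some a).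
  move=> s s' sT s'T /eqP sp /eqP sq E; apply: (Hex _ _ sT s'T sp sq).
  by rewrite !eval_seq_val1 ?E //; [exact: Tqs|exact: Tps].
(* The order follows [xs]: [c], [d], then the copies at offsets [2] and [2 + k]. *)
pose vs s := [:: ~~ d, d & R s ++ R' s].
pose up s := update xs (fun y => nth false (vs s) (y - n)) s.
have szvs s : size (vs s) = (k + k).+2 by rewrite /= size_cat szR szR'.
have up_vs s i j : i + j <= (k + k).+2 ->
    eval_seq (up s) (iota (n + i) j) = [seq Some b | b <- take j (drop i (vs s))].
  move=> ij; rewrite eval_update_iota ?leq_addr //.
  - by rewrite addKn.
  - by rewrite -addnA leq_add2l.
  - by rewrite addKn szvs.
have upc s : (up s).[? n] = Some (~~ d).
  by have := up_vs s 0 1 isT; rewrite addn0 => -[].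
have upd s : (up s).[? n.+1] = Some d.
  by have := up_vs s 1 1 isT; rewrite addn1 => -[].
have upr s : eval_seq (up s) (iota n.+2 k) = [seq Some b | b <- R s].
  by rewrite -addn2 up_vs ?leq_add2l ?leq_addr //= drop0 take_size_cat.
have upr' s : eval_seq (up s) (iota (n.+2 + k) k) = [seq Some b | b <- R' s].
  rewrite -[n.+2]addn2 -addnA up_vs // /= drop_size_cat //.
  by rewrite take_oversize ?szR'.
have up_variant s : variant xs s (up s) by exact: variant_update.
have up_out s y : y \in (p :: ps) ++ (q :: qs) -> (up s).[? y] = s.[? y].
  by move=> /fresh_xs; apply: variant_out (up_variant s).
have up_dom s y : s \in T -> y \in (p :: ps) ++ (q :: qs) -> y \in domf (up s).
  by move=> sT yin; rewrite -fndSome up_out // fndSome Tdom.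
apply/sat_exs; exists [fset up s | s in T]; split; last first.
- by move=> _ /imfsetP[s /= sT ->]; exists s => //; exact: up_variant.
- by move=> s sT; exists (up s); [apply/imfsetP; exists s|exact: up_variant].
split.
  split=> _ _ /imfsetP[s /= sT ->] /imfsetP[s' /= s'T ->].
    by rewrite /eval_seq /= upc upd; case: (d).
  by rewrite upr upr' => /(inj_map Some_inj) /(RR' _ _ sT s'T).
apply/(sat_flat _ (flat_branch_matrix _ _ _ _ _ _ _)) => _ /imfsetP[s /= sT ->].
(* Original symbols keep their values in [up s], and the symbol [n.+1] carries [d]. *)
have val1_up zs : {subset zs <= (p :: ps) ++ (q :: qs)} ->
    [seq Some (val1 (up s) x && val1 (up s) n.+1) | x <- zs] =
    [seq Some b | b <- [seq val1 s x && d | x <- zs]].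
  move=> Hzs; rewrite -map_comp; apply/eq_in_map=> x /Hzs xin /=.
  by rewrite /val1 up_out // upd; case: (d).
have d_dom : n.+1 \in domf (up s) by rewrite -fndSome upd.
have p_in : p \in (p :: ps) ++ (q :: qs) by rewrite mem_head.
have q_in : q \in (p :: ps) ++ (q :: qs) by rewrite mem_cat mem_head orbT.
have ps_in : {subset ps <= (p :: ps) ++ (q :: qs)}.
  by move=> y yps; rewrite mem_cat inE yps orbT.
have qs_in : {subset qs <= (p :: ps) ++ (q :: qs)}.
  by move=> y yqs; rewrite mem_cat !inE yqs !orbT.
rewrite holds_conj all_cat /= upc upd; apply/andP; split; last by case: (d).
apply/andP; split; apply: holds_copy_form => //; rewrite ?size_iota //.
- exact: up_dom.
- by move=> y /ps_in; apply: up_dom.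
- by rewrite upr val1_up // up_out // => sp; rewrite RA // sp.
- exact: up_dom.
- by move=> y /qs_in; apply: up_dom.
- by rewrite upr' val1_up // up_out // => sq; rewrite RB // sq.
Qed.

End Branch.

(** * Conjunction of the two branches *)

Theorem proposition4p4 (k : nat) (hk : (1 <= k)%N)
    (ps qs : (k.+1).-tuple symbol) :
  exists phi : formula, QPL_excl k 4 phi /\ equivalent (Excl ps qs) phi.
Proof.
case/tupleP: ps => p ps; case/tupleP: qs => q qs.
pose syms := (p :: ps) ++ (q :: qs).
(* All symbols from [n] on are fresh. *)
pose n := (\max_(y <- syms) y).+1.
have fresh : {in syms, forall y, y < n}.
  by move=> y yin; rewrite ltnS; apply: leq_bigmax_seq.
pose br a := branch a k n p q ps qs.
have brFV a := FV_branch a hk (size_tuple ps) (size_tuple qs) fresh.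
exists (And (br true) (br false)); split.
  split; last by apply/andP; split; apply: excl_arity_le_branch.
  rewrite -[num_excl _]/(num_excl (br true) + num_excl (br false))%N.
  by rewrite !num_excl_branch.
split.
  apply/fsetP=> y; rewrite -[FV (And _ _)]/(FV (br true) `|` FV (br false)).
  by rewrite in_fsetU !brFV orbb mem_cat FV_Excl.
move=> V T TV /fsubsetP FVV.
have Tdom : {in T, forall s : evaluation, {subset syms <= domf s}}.
  move=> s sT y yin; rewrite (TV s sT); apply: FVV.
  by rewrite FV_Excl -mem_cat.
split.
  move=> H; split; apply: (branch_complete hk (size_tuple _) (size_tuple _) fresh Tdom);
  move=> s s' sT s'T sp sq E; apply: (H s s' sT s'T);
  by rewrite /eval_seq /= sp sq; congr (_ :: _).
move=> [H1 H0] s s' sT s'T [Epq E].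
(* Equal tuples have equal first values; this common value selects the branch that is
   contradicted. *)
have sp : s.[? p] = Some (val1 s p) by rewrite val1K // (Tdom s sT) ?mem_head.
move: sp (sp); rewrite {1}Epq.
case: (val1 s p) => sq sp.
  exact: (branch_sound (size_tuple _) (size_tuple _) fresh H1 sT s'T sp sq).
exact: (branch_sound (size_tuple _) (size_tuple _) fresh H0 sT s'T sp sq).
Qed.
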